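(* Let $n \geq 5$ and let $\overrightarrow{S_n}$ be the oriented star graph defined in the context. Then the (directed) diameter of $\overrightarrow{S_n}$ is at least $2n-1$. Further, if $n \neq 6$, the diameter of $\overrightarrow{S_n}$ is at least $2n$.
   Context: For $n \ge 2$, the $n$-star graph $S_n$ has as vertices the $n!$ permutations of $[n]=\{1,\dots,n\}$ (a permutation $\pi$ is viewed as the sequence $\pi(1)\pi(2)\cdots\pi(n)$ of values in positions $1,\dots,n$); two permutations are adjacent iff one is obtained from the other by exchanging the values in position $1$ and position $i$ for some $i\in\{2,\dots,n\}$. The sign of a permutation is the parity of its number of inversions (pairs $x<y$ with $\pi(x)>\pi(y)$); adjacent permutations have opposite signs. Let $k=\lceil (n-1)/2\rceil+1$. The oriented star graph $\overrightarrow{S_n}$ (Fujita's orientation) orients each edge $\{\pi,\pi'\}$, where $\pi$ is even and $\pi'$ is obtained from $\pi$ by exchanging positions $1$ and $i$, as the arc $\pi\to\pi'$ if $i\in\{2,\dots,k\}$ and as the arc $\pi'\to\pi$ if $i\in\{k+1,\dots,n\}$. Equivalently, from an even permutation one may move by swapping position $1$ with a position in $\{2,\dots,k\}$, and from an odd permutation by swapping position $1$ with a position in $\{k+1,\dots,n\}$. The diameter of a directed graph is the maximum over ordered pairs $(u,v)$ of the length of a shortest directed path from $u$ to $v$. *)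

(* Defs.v *)
From mathcomp Require Import all_boot all_fingroup.

Set Implicit Arguments.
Unset Strict Implicit.
Unset Printing Implicit Defensive.

Section Digraph.

Variables (T : finType) (e : rel T).

Definition walk_of_length (m : nat) (u v : T) : bool :=
  [exists p : m.-tuple T, path e u p && (last u p == v)].

(* A shortest path has fewer than #|T| arcs; the value #|T|, returned by [find]
   exactly when v is unreachable from u, plays the role of infinity. *)
Definition dist (u v : T) : nat :=
  find (fun m => walk_of_length m u v) (iota 0 #|T|).

Definition diameter : nat := \max_(u : T) \max_(v : T) dist u v.

Lemma walk_of_lengthP m u v :
  reflect (exists p, [/\ path e u p, last u p = v & size p = m])
          (walk_of_length m u v).
Proof.
apply: (iffP existsP) => [[p /andP[ep /eqP lp]]|[p [ep lp /eqP sp]]].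
  by exists p; rewrite size_tuple.
by exists (Tuple sp); rewrite /= ep lp eqxx.
Qed.

Lemma dist_lt_card u v : (dist u v < #|T|) = connect e u v.
Proof.
rewrite /dist -[X in _ < X](size_iota 0) -has_find.
apply/hasP/connectP => [[m _ /walk_of_lengthP[p [ep lp _]]]|[p ep ->]].
  by exists p.
case/shortenP: ep => p' ep' Up' _; exists (size p').
  by rewrite mem_iota /= add0n -[(size p').+1]/(size (u :: p')) -(card_uniqP Up') max_card.
by apply/walk_of_lengthP; exists p'.
Qed.

Lemma dist_walk u v : connect e u v -> walk_of_length (dist u v) u v.
Proof.
rewrite -dist_lt_card => d_lt.
have h: has (fun m => walk_of_length m u v) (iota 0 #|T|).
  by rewrite has_find size_iota.
by have := nth_find 0 h; rewrite nth_iota.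
Qed.

Lemma dist_le u v p : path e u p -> last u p = v -> dist u v <= size p.
Proof.
move=> ep lp; rewrite leqNgt; apply/negP => lt_pd.
have dT : dist u v <= #|T|.
  by rewrite -[X in _ <= X](size_iota 0) find_size.
have := before_find 0 lt_pd; rewrite nth_iota ?(leq_trans lt_pd) //= add0n.
by move/negbT/negP; apply; apply/walk_of_lengthP; exists p.
Qed.

End Digraph.

Section Inversions.

Variable n : nat.
Implicit Types s t : 'S_n.

Definition inversions s : {set 'I_n * 'I_n} :=
  [set xy : 'I_n * 'I_n | (xy.1 < xy.2) && (s xy.2 < s xy.1)].

Let ip s := \big[addb/false]_(ij : 'I_n * 'I_n | ij.1 < ij.2) (s ij.2 < s ij.1).

Let ipE s : odd #|inversions s| = ip s.
Proof.
rewrite cardsE -sum1_card (big_morph odd oddD (erefl : odd 0 = false)) /ip.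
rewrite big_mkcond [RHS]big_mkcond /=; apply: eq_bigr => -[i j] _ /=.
by rewrite unfold_in /=; case: (i < j); case: (s j < s i).
Qed.

Let ipM s t : ip (s * t)%g = ip s (+) ip t.
Proof.
pose h s (ij : 'I_n * 'I_n) :=
  if s ij.1 < s ij.2 then (s ij.1, s ij.2) else (s ij.2, s ij.1).
have hK s1 (ij : 'I_n * 'I_n) : ij.1 < ij.2 -> h s1^-1%g (h s1 ij) = ij.
  case: ij => i j /= lt_ij; rewrite /h /=.
  by case: (ltnP (s1 i) (s1 j)) => _ /=; rewrite !permK ?lt_ij // ltnNge (ltnW lt_ij).
have hlt s1 (ij : 'I_n * 'I_n) : ij.1 < ij.2 -> (h s1 ij).1 < (h s1 ij).2.
  case: ij => i j /= lt_ij; rewrite /h /=.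
  case: (ltngtP (s1 i) (s1 j)) => //= /val_inj /perm_inj eij.
  by rewrite eij ltnn in lt_ij.
have -> : ip t = \big[addb/false]_(ij : 'I_n * 'I_n | ij.1 < ij.2)
    (t (h s ij).2 < t (h s ij).1).
  rewrite /ip (reindex_onto (h s) (h s^-1%g)) => [|ij lt_ij] /=; last first.
    by rewrite -{1}[s]invgK hK.
  apply: eq_bigl => ij; apply/andP/idP => [[h1 /eqP <-]|lt_ij].
    exact: hlt.
  by rewrite hK // hlt.
rewrite /ip -big_split /=; apply: eq_bigr => -[i j] /= lt_ij.
rewrite /h /= !permM.
case: (ltngtP (s i) (s j)) => //= [_|/val_inj /perm_inj eij].
  case: (ltngtP (t (s i)) (t (s j))) => //= /val_inj /perm_inj /perm_inj eij.
  by rewrite eij ltnn in lt_ij.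
by rewrite eij ltnn in lt_ij.
Qed.

Lemma odd_inversions s : odd #|inversions s| = odd_perm s.
Proof.
rewrite ipE.
have ip1 : ip (1%g : 'S_n) = false.
  by rewrite /ip big1 // => -[i j] /= lt; rewrite !perm1 ltnNge (ltnW lt).
have ipV (t : 'S_n) : ip t^-1%g = ip t.
  by move: (ipM t t^-1%g); rewrite mulgV ip1; case: (ip t); case: (ip _).
have ipJ t u : ip (t ^ u)%g = ip t.
  by rewrite conjgE ipM ipV ipM addbC -addbA addbb addbF.
have ipt (x y : 'I_n) : x != y -> ip (tperm x y).
  move=> nxy; have n2 : 1 < n.
    rewrite ltnNge; apply: contra nxy => n1; apply/eqP/val_inj => /=.
    have := leq_trans (ltn_ord x) n1; have := leq_trans (ltn_ord y) n1.
    by rewrite !ltnS !leqn0 => /eqP -> /eqP ->.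
  pose a := Ordinal (ltnW n2); pose b := Ordinal n2.
  have nab : a != b by [].
  have ipab : ip (tperm a b).
    rewrite /ip (bigD1 (a, b)) //= tpermL tpermR /= big1 //.
    move=> [i j] /= /andP[lt_ij nij].
    have E (z : 'I_n) :
        tperm a b z = (if z == 0 :> nat then 1 else if z == 1 :> nat then 0 else z) :> nat.
      by case: tpermP => [->|->|/eqP + /eqP]//; rewrite -!val_eqE /= => /negbTE-> /negbTE->.
    move: nij; rewrite !E xpair_eqE -!val_eqE /=.
    by move: i j lt_ij => [[|[|i]] hi] [[|[|j]] hj] //= lt_ij _; apply/negbTE; rewrite -leqNgt ltnW.
  pose c := tperm a x b.
  have -> : tperm x y = (tperm a b ^ (tperm a x * tperm c y))%g.
    rewrite conjgM !tpermJ tpermL -/c tpermL tpermD //; last by rewrite eq_sym.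
    by rewrite /c -[X in _ != X](tpermL a x) (inj_eq perm_inj) eq_sym.
  by rewrite ipJ.
have [ts -> dts] := prod_tpermP s.
elim: ts dts => [|[x y] ts IH] /=; first by rewrite !big_nil ip1 odd_perm1.
case/andP; rewrite /dpair /= => nxy /IH E.
by rewrite !big_cons ipM odd_permM odd_tperm E ipt // nxy.
Qed.

End Inversions.

Section OrientedStar.

Variable n : nat.
Implicit Types s t : 'S_n.

(* The element i of 'I_n stands for the position (or value) i + 1. Products act
   left to right: [(tperm o i * s) x = s (tperm o i x)], so the values of [s] in
   positions o and i are exchanged. *)
Definition swap_first (i : 'I_n) s t : bool :=
  [exists o : 'I_n, (o == 0 :> nat) && (t == (tperm o i * s)%g)].

Definition fujita_k : nat := (uphalf n.-1).+1.

(* The sign of [s] is [odd_perm s]; [odd_inversions] identifies it with the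
   parity of the number of inversions. *)
Definition oriented_star : rel 'S_n := fun s t =>
  [exists i : 'I_n,
     [&& ~~ odd_perm s, swap_first i s t & 2 <= i.+1 <= fujita_k]
  || [&& ~~ odd_perm t, swap_first i t s & fujita_k.+1 <= i.+1 <= n]].

End OrientedStar.

Arguments oriented_star n : clear implicits.

(* Main.v *)
(** Call the positions 2..k left and k+1..n right. A walk carries the value in
    position 1 around: each arc drops it in some position and picks up the
    value found there, and the sides of these positions alternate. So a value
    changes sides each time it is picked up and dropped again, and a value that
    has to reach another position on its own side is picked up at least twice.
    If u fixes position 1, preserves both sides and has no other fixed point,
    then reaching the identity from u takes 2(n - 1) pick-ups for the values
    other than 1. Moreover, if u is even then the value 1 is dropped on the left
    by the first arc and picked up on the right by the last one, hence at least
    2 more pick-ups; if u is odd, at least 1 more. An even u of this kind exists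
    for every n >= 5 except n = 6, where the sides have 3 and 2 elements. *)
Require Import Defs.
From mathcomp Require Import all_boot all_fingroup zify.

Set Implicit Arguments.
Unset Strict Implicit.
Unset Printing Implicit Defensive.

(** * Permutations with prescribed support and sign *)

Section Support.

Variable T : finType.
Implicit Types (A B : {set T}) (s t : {perm T}).

Definition has_support s A := forall x, (s x != x) = (x \in A).

Lemma has_support_closed s A x : has_support s A -> (s x \in A) = (x \in A).
Proof. by move=> sA; rewrite -!sA (inj_eq perm_inj). Qed.

Lemma has_support_out s A x : has_support s A -> x \notin A -> s x = x.
Proof. by move=> sA; rewrite -sA negbK => /eqP. Qed.

Lemma has_support_tperm x y : x != y -> has_support (tperm x y) [set x; y].
Proof.
move=> nxy z; rewrite !inE; case: tpermP => [->|->|/eqP/negbTE-> /eqP/negbTE->].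
- by rewrite eq_sym nxy eqxx.
- by rewrite nxy eqxx orbT.
- by rewrite eqxx.
Qed.

Lemma has_supportM s t A B : [disjoint A & B] ->
  has_support s A -> has_support t B -> has_support (s * t)%g (A :|: B).
Proof.
move=> dAB sA tB x; rewrite permM inE.
have [xA|xA] /= := boolP (x \in A).
  rewrite (has_support_out tB) ?sA //.
  by rewrite (disjointFr dAB) // (has_support_closed _ sA).
by rewrite (has_support_out sA xA) tB.
Qed.

(** The witness is a cycle through all of [A]: a transposition involving [x] inserts [x] into a
    cycle on [A :\ x] and flips the sign. *)
Lemma exists_cycle A : 1 < #|A| ->
  exists2 s, has_support s A & odd_perm s = ~~ odd #|A|.
Proof.
have [m] := ubnP #|A|; elim: m A => // m IH A ltAm A_gt1.
have [x [y [xA yA nxy]]] := card_gt1P A_gt1.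
have cA : #|A| = #|A :\ x|.+1 by rewrite (cardsD1 x) xA.
have yAx : y \in A :\ x by rewrite !inE eq_sym nxy.
have [A_gt2|A_le2] := ltnP 2 #|A|; last first.
  exists (tperm x y); last by rewrite odd_tperm nxy; case: #|A| A_gt1 A_le2 => [|[|[]]].
  suff -> : A = [set x; y] by exact: has_support_tperm.
  by apply/esym/eqP; rewrite eqEcard cards2 nxy subUset !sub1set xA yA.
have [||s sA os] := IH (A :\ x); [lia | lia |].
have xAx : x \notin A :\ x by rewrite !inE eqxx.
exists (tperm x y * s)%g; last by rewrite odd_permM odd_tperm nxy os cA /= negbK.
move=> z; rewrite permM; case: tpermP => [->|->|/eqP nzx _].
- by rewrite xA; apply: contraNneq xAx => syx; rewrite -{1}syx (has_support_closed _ sA).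
- by rewrite (has_support_out sA xAx) nxy yA.
- by rewrite sA !inE nzx.
Qed.

(** Splitting a full cycle into a transposition and a cycle on the remaining elements, at least two
    of them, gives the other sign. *)
Lemma exists_support_parity A b : 1 < #|A| -> b = ~~ odd #|A| \/ 3 < #|A| ->
  exists2 s, has_support s A & odd_perm s = b.
Proof.
move=> A_gt1; have [-> _|nb [->|A_gt3]] := eqVneq b (~~ odd #|A|).
- exact: exists_cycle.
- exact: exists_cycle.
have [x [y [xA yA nxy]]] := card_gt1P A_gt1.
have sub : [set x; y] \subset A by rewrite subUset !sub1set xA yA.
have cA : #|A| = #|A :\: [set x; y]| + 2.
  by rewrite -(cardsID [set x; y] A) (setIidPr sub) cards2 nxy addnC.
have [|s sA os] := @exists_cycle (A :\: [set x; y]); first lia.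
exists (tperm x y * s)%g.
  rewrite -[A](setID _ [set x; y]) (setIidPr sub).
  apply: has_supportM (has_support_tperm nxy) sA.
  by rewrite -setI_eq0 setIDA setDIl setDv set0I.
by move: nb; rewrite odd_permM odd_tperm nxy os cA oddD /= addbF; case: b; case: odd.
Qed.

End Support.

(** * The pick-up potential along walks *)

Section Potential.

Variables (n : nat) (o : 'I_n).
Hypothesis o0 : o = 0 :> nat.
Implicit Types (s t : 'S_n) (x p : 'I_n) (b : bool).

Definition left_side p := p < fujita_k n.

(* A lower bound on the number of pick-ups of the value [x], in position [p] of
   a permutation of parity [b], on the way to the identity. A held value is
   about to be dropped on the left iff [b] is [false]. *)
Definition pickups b x p : nat :=
  if p == o then nat_of_bool (if x == o then b else left_side x == b)
  else if x == o then (left_side p).+1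
  else if p == x then 0
  else (left_side p == left_side x).+1.

Definition potential s := \sum_p pickups (odd_perm s) (s p) p.

Lemma potential1 : potential 1 = 0.
Proof.
rewrite /potential big1 // => p _.
by rewrite perm1 odd_perm1 /pickups; case: eqVneq => // _; rewrite eqxx.
Qed.

(** Transpositions are involutions, so an edge traversed from its odd end is also a left
    multiplication by [tperm o a], now with [a] on the right. *)
Lemma oriented_starP s t : oriented_star n s t ->
  exists a, [/\ a != o, left_side a = ~~ odd_perm s & t = (tperm o a * s)%g].
Proof.
case/existsP=> a ha; exists a.
have swapE s' t' : swap_first a s' t' -> t' = (tperm o a * s')%g.
  case/existsP=> o' /andP[/eqP o'0 /eqP ->].
  by have -> : o' = o by apply: val_inj; rewrite /= o'0 o0.
have neq_o : 0 < a -> a != o by rewrite -val_eqE /= o0 lt0n.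
case/orP: ha => /and3P[sgn /swapE E /andP[a1 a2]].
  by split=> //; [exact: neq_o | rewrite sgn].
have nao : a != o by apply: neq_o; rewrite -ltnS (leq_trans _ a1).
split=> //; last by rewrite E mulgA tperm2 mul1g.
by rewrite E odd_permM odd_tperm eq_sym nao (negbTE sgn) /left_side ltnNge -ltnS a1.
Qed.

(** Terms at positions other than [o] do not depend on the sign, so only those at [o] and [a]
    change. The crosswise form avoids truncated subtraction. *)
Lemma potential_swap s a : a != o ->
  let b := odd_perm s in let t := (tperm o a * s)%g in
  potential s + pickups (~~ b) (s a) o + pickups (~~ b) (s o) a
    = potential t + pickups b (s o) o + pickups b (s a) a.
Proof.
move=> nao b t; have ob : odd_perm t = ~~ b by rewrite odd_permM odd_tperm eq_sym nao.
have sumE (F : 'I_n -> nat) :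
    \sum_p F p = F o + F a + \sum_(p | (p != o) && (p != a)) F p.
  by rewrite (bigD1 o) //= (bigD1 a) //= addnA.
rewrite /potential ob !sumE !permM tpermL tpermR -/b.
under [in RHS]eq_bigr => p /andP[npo npa].
  rewrite permM tpermD 1?eq_sym // /pickups (negbTE npo).
  over.
under [in LHS]eq_bigr => p /andP[npo npa].
  rewrite /pickups (negbTE npo).
  over.
by lia.
Qed.

(** Dropping the held value never lowers its term; picking up the new one lowers its term by at most
    1. *)
Lemma potential_step s t : oriented_star n s t ->
  potential s <= (potential t).+1.
Proof.
case/oriented_starP=> a [nao la ->].
have := potential_swap s nao; have : s o != s a by rewrite (inj_eq perm_inj) eq_sym.
rewrite /pickups eqxx (negbTE nao); move: (s o) (s a) => x y nxy /=.
(* With these three facts the tests on [x] and [y] can be treated as independent booleans. *)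
have : ~~ ((x == o) && (y == o)) by apply: contra nxy => /andP[/eqP-> /eqP->].
have : (a == x) ==> (left_side x == left_side a) by apply/implyP => /eqP->.
have : (a == y) ==> (left_side y == left_side a) by apply/implyP => /eqP->.
rewrite la; case: (odd_perm s); case: (left_side x); case: (left_side y);
  case: (a == x); case: (a == y); case: (x == o); case: (y == o) => //=; lia.
Qed.

(** Dropping the value [o] on the left raises its term from 0 to 2, which outweighs the loss of at
    most 1 from the pick-up. *)
Lemma potential_first_step s t : s o = o -> ~~ odd_perm s ->
  oriented_star n s t -> potential s < potential t.
Proof.
move=> so os /oriented_starP[a [nao la ->]].
have := potential_swap s nao.
have sao : (s a == o) = false by rewrite -so (inj_eq perm_inj) (negbTE nao).
rewrite /pickups so eqxx sao (negbTE nao) la (negbTE os) /=.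
move: (potential (_ * _)) (potential s) => Q P.
case: (eqVneq a (s a)) => [<-|_]; first by rewrite la os; lia.
by case: (left_side (s a)) => /=; lia.
Qed.

Lemma potential_path s (w : seq 'S_n) : path (oriented_star n) s w -> last s w = 1%g ->
  potential s <= size w.
Proof.
elim: w s => /= [s _ ->|t w IH s /andP[st tw] lw]; first by rewrite potential1.
by apply: leq_trans (potential_step st) _; rewrite ltnS IH.
Qed.

Lemma potential_derangement s : s o = o ->
  (forall p, p != o -> s p != p /\ left_side (s p) = left_side p) ->
  potential s = odd_perm s + 2 * n.-1.
Proof.
move=> so sP; rewrite /potential (bigD1 o) //= {1}/pickups so eqxx; congr (_ + _).
rewrite (eq_bigr (fun=> 2)) => [|p npo].
  by rewrite sum_nat_const cardC1 card_ord mulnC.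
have [nsp lsp] := sP p npo.
by rewrite /pickups (negbTE npo) -[X in s p == X]so (inj_eq perm_inj) (negbTE npo) eq_sym
  (negbTE nsp) lsp eqxx.
Qed.

Lemma walk_derangement s (w : seq 'S_n) : 1 < n -> s o = o ->
  (forall p, p != o -> s p != p /\ left_side (s p) = left_side p) ->
  path (oriented_star n) s w -> last s w = 1%g ->
  2 * n - odd_perm s <= size w.
Proof.
move=> n_gt1 so sP sw lw; have := potential_derangement so sP.
have [os|os] := boolP (odd_perm s); first by have := potential_path sw lw; lia.
case: w sw lw => /= [_ s1|t w /andP[st tw] lw].
  by rewrite s1 potential1; lia.
by have := potential_first_step so os st; have := potential_path tw lw; lia.
Qed.

End Potential.

(** * From walk lengths to the diameter *)

Lemma leq_diameter (T : finType) (e : rel T) u v m : m <= #|T| ->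
  (forall p, path e u p -> last u p = v -> m <= size p) -> m <= diameter e.
Proof.
move=> mT mP; suff le_m : m <= dist e u v.
  by apply: (leq_trans le_m); rewrite /diameter (bigD1 u) //= (bigD1 v) //= -maxnA leq_maxl.
have [/dist_walk/walk_of_lengthP[p [ep lp <-]]|] := boolP (connect e u v).
  exact: mP.
(* For unreachable [v] the distance is at least [#|T|], hence at least [m]. *)
by rewrite -dist_lt_card -leqNgt; apply: leq_trans.
Qed.

Lemma card_ord_lt n m : m <= n -> #|[set i : 'I_n | i < m]| = m.
Proof.
move=> le_mn; rewrite -sum1_card.
under eq_bigl do rewrite inE.
by rewrite -(big_ord_widen _ (fun=> 1)) // sum1_card card_ord.
Qed.

Lemma exists_side_derangement n (o : 'I_n) : 4 < n -> o = 0 :> nat ->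
  exists s : 'S_n, [/\ s o = o,
    forall p, p != o -> s p != p /\ left_side (s p) = left_side p
    & n <> 6 -> ~~ odd_perm s].
Proof.
move=> n_gt4 o0; pose A := [set i : 'I_n | i < fujita_k n].
have kn : fujita_k n <= n by rewrite /fujita_k; lia.
have oA : o \in A by rewrite inE o0.
have cL : #|A :\ o| = uphalf n.-1.
  by have := cardsD1 o A; rewrite oA card_ord_lt // /fujita_k; lia.
have cR : #|~: A| = n.-1./2.
  by have := cardsC A; rewrite card_ord card_ord_lt // /fujita_k; lia.
have [|s sR os] := @exists_cycle _ (~: A); first by rewrite cR; lia.
(* Equal signs on the two sides make the product even; for [n = 6] the sign of a 3-cycle is the only
   one available on the left. *)
pose b := if n == 6 then ~~ odd #|A :\ o| else odd_perm s.
have [||t tL ot] := @exists_support_parity _ (A :\ o) b.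
- by rewrite cL; lia.
(* For [n = 5] and [n = 7] both sides have the same size; for [n >= 8] the left one has at least 4
   elements. *)
- by rewrite /b os cL cR; case: eqVneq => [->|]; [left | lia].
have dLR : [disjoint A :\ o & ~: A].
  by rewrite -setI_eq0 setIDAC setICr set0D.
have st := has_supportM dLR tL sR.
exists (t * s)%g; split.
- by apply: (has_support_out st); rewrite !inE eqxx o0.
- move=> p npo; rewrite st !inE npo -/(left_side p) orbN; split=> //.
  have lA q : left_side q = (q \in A) by rewrite inE.
  have sA q : (s q \in A) = (q \in A).
    by apply/negb_inj; rewrite -!in_setC (has_support_closed _ sR).
  have [pL|pL] := boolP (p \in A :\ o); last by rewrite permM (has_support_out tL pL) !lA sA.
  move: (pL); rewrite -(has_support_closed _ tL) permM !lA sA.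
  by case/setD1P: pL => _ -> /setD1P[].
- by move=> n6; rewrite odd_permM ot /b; case: eqVneq => // _; rewrite addbb.
Qed.

Theorem theorem1 (n : nat) (hn : 5 <= n) :
  2 * n - 1 <= diameter (oriented_star n) /\
  (n <> 6 -> 2 * n <= diameter (oriented_star n)).
Proof.
pose o : 'I_n := Ordinal (leq_trans (isT : 0 < 5) hn).
have [s [so sP os]] := @exists_side_derangement n o hn erefl.
have n2_card : 2 * n <= #|{: 'S_n}|.
  rewrite card_Sn; case: n hn {o s so sP os} => [|[|n]] // hn.
  by rewrite factS mulnC leq_mul2l /= factS; have := fact_gt0 n; nia.
have bound : 2 * n - odd_perm s <= diameter (oriented_star n).
  apply: (leq_diameter (u := s) (v := 1%g)) => [|p sp lp].
    exact: leq_trans (leq_subr _ _) n2_card.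
  by apply: (walk_derangement _ _ so sP sp lp); last lia.
split=> [|n6]; first by move: bound; case: odd_perm; lia.
by move: bound; rewrite (negbTE (os n6)) subn0.
Qed.
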